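(* Let $A \in \mathbb{R}^{n \times n}$ be of the tridiagonal form $$A = \begin{pmatrix} a_{1} & u_{1} & 0 & \cdots & 0 & 0 \\ l_{1} & a_{2}& u_{2} & \cdots & 0 &0 \\ 0 & l_{2} & a_{3} & \cdots & 0 & 0\\ \vdots & \vdots & \vdots & \ddots & \vdots & \vdots \\ 0 & 0 & 0 & \cdots & a_{n-1} & u_{n-1}\\ 0 & 0 & 0 & \cdots & l_{n-1} & a_{n} \end{pmatrix},$$ where $l_i u_i\geq 0$ for $i=1,\ldots,n-1$. Let $B = e_k b^T$ for some $b \in \mathbb{R}^n$ and some $k \in \{1, \ldots, n\}$. Then $(A, B)$ is diagonally Riccati stable if and only if $\hat A + \bar B$ is Hurwitz.
   Context: $M \succ 0$ ($M \prec 0$) means that the real matrix $M=M^T$ is positive definite (negative definite). A pair $(A,B)$ of matrices in $\mathbb{R}^{n\times n}$ is diagonally Riccati stable if there exist diagonal $P \succ 0$, $Q \succ 0$ in $\mathbb{R}^{n \times n}$ with $A^TP+PA + Q + PBQ^{-1}B^TP \prec 0$. A real square matrix is Hurwitz if all its eigenvalues have negative real part. $e_1,\dots,e_n$ is the standard basis of $\mathbb{R}^n$. For $C \in \mathbb{R}^{n\times n}$, $\hat C$ is the matrix with $\hat c_{ii}=c_{ii}$ and $\hat c_{ij}=|c_{ij}|$ for $i\neq j$, and $\bar C$ is the matrix with $\bar c_{ij}=|c_{ij}|$ for all $i,j$. *)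

(* Defs.v *)
From mathcomp Require Import all_boot all_order all_algebra.
From mathcomp Require Import complex reals.

Set Implicit Arguments.
Unset Strict Implicit.
Unset Printing Implicit Defensive.

Import Order.TTheory GRing.Theory Num.Theory.
Local Open Scope ring_scope.

Definition posdef (R : realType) (n : nat) (M : 'M[R]_n) : Prop :=
  M^T = M /\ forall x : 'cV[R]_n, x != 0 -> 0 < (x^T *m M *m x) 0 0.

Definition negdef (R : realType) (n : nat) (M : 'M[R]_n) : Prop :=
  M^T = M /\ forall x : 'cV[R]_n, x != 0 -> (x^T *m M *m x) 0 0 < 0.

Definition diag_Riccati_stable (R : realType) (n : nat) (A B : 'M[R]_n) : Prop :=
  exists P Q : 'M[R]_n,
    [/\ is_diag_mx P, posdef P, is_diag_mx Q, posdef Q &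
        negdef (A^T *m P + P *m A + Q + P *m B *m invmx Q *m B^T *m P)].

(* [eigenvalue] only ranges over the base field, so the matrix is first viewed
   over [R[i]]. *)
Definition Hurwitz (R : realType) (n : nat) (M : 'M[R]_n) : Prop :=
  forall z : R[i], eigenvalue (map_mx (real_complex R) M) z -> complex.Re z < 0.

Definition hat_mx (R : realType) (n : nat) (C : 'M[R]_n) : 'M[R]_n :=
  \matrix_(i, j) (if i == j then C i j else `|C i j|).

Definition bar_mx (R : realType) (n : nat) (C : 'M[R]_n) : 'M[R]_n :=
  \matrix_(i, j) `|C i j|.

(* Indices start at 0: [u i] is the entry (i, i+1) and [l i] the entry (i+1, i),
   for i < n - 1; each of the two inner sums has at most one nonzero term. *)
Definition tridiag_mx (R : realType) (n : nat)
    (a : 'I_n -> R) (u l : 'I_n.-1 -> R) : 'M[R]_n :=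
  \matrix_(i, j)
    (a i *+ (i == j)
     + \sum_(m < n.-1) u m *+ ((i == m :> nat) && (j == m.+1 :> nat))
     + \sum_(m < n.-1) l m *+ ((i == m.+1 :> nat) && (j == m :> nat))).

(* Main.v *)
Require Import Defs.
From mathcomp Require Import all_boot all_order all_algebra.
From mathcomp Require Import complex reals.
From mathcomp Require Import ring lra.
From mathcomp Require classical_sets.

Set Implicit Arguments.
Unset Strict Implicit.
Unset Printing Implicit Defensive.

Import Order.TTheory GRing.Theory Num.Theory.
Local Open Scope ring_scope.

(** Since B = e_k b^T, only the squares of the entries of b enter
    B Q^-1 B^T, and since l_i u_i >= 0, the two off-diagonal entries of A at
    the same place share a sign.  Hence there are signature matrices S, T
    (diagonal, with entries 1 and -1) such that hat A = S A S and
    bar B = S B T; for A one chooses the entries of S one after the other so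
    that consecutive ones multiply to the sign of the corresponding
    off-diagonal pair.  Diagonal Riccati stability is invariant under
    (A, B) |-> (S A S, S B T), because signature matrices commute with the
    diagonal unknowns P and Q.  This reduces the claim to a pair (A, B) with A
    Metzler (off-diagonal entries >= 0) and B entrywise nonnegative.

    For such pairs Riccati stability is equivalent to A + B being Hurwitz
    ([Metzler_diag_Riccati_stableP]).  Necessity holds for arbitrary pairs:
    completing the square shows that the matrix P of the Riccati inequality
    satisfies the Lyapunov inequality for A + B ([diag_Riccati_Lyapunov],
    [Lyapunov_Hurwitz]).  For sufficiency, a Metzler matrix M without
    nonnegative real eigenvalue has a vector v > 0 with M v < 0
    ([subinvariant0]).  Applied to A + B and to its transpose, this gives v
    and w; with P v = w and Q v slightly larger than B^T w, the Riccati matrix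
    is symmetric, Metzler, and maps v to a negative vector, which makes it
    negative definite ([Metzler_negdef],
    [Metzler_diag_Riccati_stable_of_subinvariant]). *)

(** * Matrix identities *)

Lemma addmxE (V : zmodType) (m n : nat) (X Y : 'M[V]_(m, n)) i j :
  (X + Y) i j = X i j + Y i j.
Proof. by rewrite mxE. Qed.

Lemma mul_diag_mx_coef (R : pzSemiRingType) (m n : nat) (d : 'rV[R]_m)
    (X : 'M[R]_(m, n)) i j :
  (diag_mx d *m X) i j = d 0 i * X i j.
Proof. by rewrite mul_diag_mx mxE. Qed.

Lemma invmx_diag (F : fieldType) (n : nat) (q : 'rV[F]_n) :
  (forall i, q 0 i != 0) -> invmx (diag_mx q) = diag_mx (\row_i (q 0 i)^-1).
Proof.
move=> q_neq0.
have qK : diag_mx q *m diag_mx (\row_i (q 0 i)^-1) = 1%:M.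
  rewrite mulmx_diag -diag_const_mx; congr diag_mx; apply/rowP => i.
  by rewrite !mxE divff.
by have [q_unit _] := mulmx1_unit qK; rewrite -[LHS]mulmx1 -qK mulKmx.
Qed.

Lemma sign_diag_mx (R : realType) (n : nat) (s : 'rV[R]_n) :
  (forall i, s 0 i * s 0 i = 1) -> diag_mx s *m diag_mx s = 1%:M.
Proof.
move=> s2; rewrite mulmx_diag -diag_const_mx; congr diag_mx.
by apply/rowP => i; rewrite !mxE.
Qed.

(** [eigenvalue] refers to row eigenvectors; this lemma gives access to column
    eigenvectors. *)
Lemma eigenvalue_tr (F : fieldType) (n : nat) (M : 'M[F]_n) z :
  eigenvalue M^T z = eigenvalue M z.
Proof.
rewrite !eigenvalue_root_char /root; congr (_.[_] == 0).
rewrite /char_poly -det_tr; congr (\det _); apply/matrixP => i j.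
by rewrite !mxE eq_sym.
Qed.

Lemma quad_formE (R : realType) (n : nat) (M : 'M[R]_n) (x : 'cV[R]_n) :
  (x^T *m M *m x) 0 0 = \sum_i \sum_j M i j * (x i 0 * x j 0).
Proof.
rewrite -mulmxA mxE; apply: eq_bigr => i _; rewrite !mxE mulr_sumr.
by apply: eq_bigr => j _; rewrite mulrCA.
Qed.

Lemma posdef_unitmx (R : realType) (n : nat) (P : 'M[R]_n) :
  posdef P -> P \in unitmx.
Proof.
case=> P_sym P_pos; rewrite unitmxE unitfE.
apply/eqP => /eqP/det0P [x x_neq0 xP].
have := P_pos x^T; rewrite trmx_eq0 trmxK xP mul0mx mxE ltxx.
by move/(_ x_neq0).
Qed.

Lemma posdef_ge0 (R : realType) (n : nat) (P : 'M[R]_n) (x : 'cV[R]_n) :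
  posdef P -> 0 <= (x^T *m P *m x) 0 0.
Proof.
case=> _ P_pos; have [->|/P_pos/ltW //] := eqVneq x 0.
by rewrite mulmx0 mxE.
Qed.

Lemma posdef_diag (R : realType) (n : nat) (p : 'rV[R]_n) :
  (forall i, 0 < p 0 i) -> posdef (diag_mx p).
Proof.
move=> p_gt0; split; first exact: tr_diag_mx.
move=> x x_neq0; rewrite quad_formE.
have E i : \sum_j diag_mx p i j * (x i 0 * x j 0) = p 0 i * (x i 0 * x i 0).
  rewrite (bigD1 i) //= big1 ?addr0; first by rewrite mxE eqxx.
  by move=> j ji; rewrite mxE eq_sym (negbTE ji) mul0r.
have Ege0 i : true -> 0 <= p 0 i * (x i 0 * x i 0).
  by move=> _; rewrite -expr2 pmulr_rge0 ?sqr_ge0.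
under eq_bigr => i _ do rewrite E.
rewrite lt_neqAle sumr_ge0 ?andbT 1?eq_sym //.
apply: contra x_neq0 => /eqP/(psumr_eq0P Ege0) x0; apply/eqP/matrixP => i j.
have /eqP := x0 i isT; rewrite ord1 mxE !mulf_eq0 orbb gt_eqF //=.
by move/eqP.
Qed.

(** * Riccati stability implies Hurwitz *)

(** Completing the square: with N = 1 - Q^-1 B^T P, the Riccati matrix of
    (A, B) exceeds the Lyapunov matrix of A + B by N^T Q N, which is positive
    semidefinite. *)
Lemma diag_Riccati_Lyapunov (R : realType) (n : nat) (A B P Q : 'M[R]_n) :
  posdef P -> posdef Q ->
  negdef (A^T *m P + P *m A + Q + P *m B *m invmx Q *m B^T *m P) ->
  negdef ((A + B)^T *m P + P *m (A + B)).
Proof.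
move=> [P_sym _] Q_pos [_ Y_neg]; have Q_unit := posdef_unitmx Q_pos.
have [Q_sym _] := Q_pos.
pose N := 1%:M - invmx Q *m (B^T *m P).
have NQN : (A + B)^T *m P + P *m (A + B) =
   A^T *m P + P *m A + Q + P *m B *m invmx Q *m B^T *m P - N^T *m Q *m N.
  have -> : N^T = 1%:M - P *m B *m invmx Q.
    by rewrite linearB /= trmx1 !trmx_mul trmx_inv trmxK P_sym Q_sym.
  rewrite /N mulmxBl mul1mx mulmxKV // mulmxBl !mulmxBr !mulmx1 mulKVmx //.
  rewrite linearD /= mulmxDl mulmxDr !mulmxA.
  by apply/matrixP => i j; rewrite !mxE; ring.
split; first by rewrite linearD /= !trmx_mul trmxK P_sym addrC.
move=> x x_neq0; rewrite NQN mulmxBr mulmxBl mxE [X in _ + X]mxE.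
have -> : x^T *m (N^T *m Q *m N) *m x = (N *m x)^T *m Q *m (N *m x).
  by rewrite trmx_mul !mulmxA.
by have := Y_neg _ x_neq0; have := posdef_ge0 (N *m x) Q_pos; lra.
Qed.

(** For an eigenvector x + i y with eigenvalue z, adding the two values of the
    Lyapunov form at x and at y cancels the terms with Im z, by symmetry of P,
    and leaves 2 Re z times the positive quantity x^T P x + y^T P y. *)
Lemma Lyapunov_Hurwitz (R : realType) (n : nat) (M P : 'M[R]_n) :
  posdef P -> negdef (M^T *m P + P *m M) -> Hurwitz M.
Proof.
move=> [P_sym P_pos] [_ L_neg] z; rewrite -eigenvalue_tr.
case/eigenvalueP => w wM w_neq0.
pose x : 'cV[R]_n := \col_i complex.Re (w 0 i).
pose y : 'cV[R]_n := \col_i complex.Im (w 0 i).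
pose al := complex.Re z; pose be := complex.Im z.
have wMi i : \sum_j w 0 j * (M i j)%:C%C = z * w 0 i.
  move/matrixP/(_ 0 i): wM; rewrite !mxE => <-.
  by apply: eq_bigr => j _; rewrite !mxE.
have Re_sum (F : 'I_n -> R[i]) :
    complex.Re (\sum_j F j) = \sum_j complex.Re (F j).
  by elim/big_rec2: _ => // j a b _ <-; case: (F j); case: b.
have Im_sum (F : 'I_n -> R[i]) :
    complex.Im (\sum_j F j) = \sum_j complex.Im (F j).
  by elim/big_rec2: _ => // j a b _ <-; case: (F j); case: b.
have Mx : M *m x = al *: x - be *: y.
  apply/matrixP => i j; rewrite ord1 !mxE /al /be.
  transitivity (complex.Re (z * w 0 i)).
    rewrite -wMi Re_sum; apply: eq_bigr => k _; rewrite mxE.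
    by case: (w 0 k) => c d /=; ring.
  by case: z {wM wMi al be} => ? ?; case: (w 0 i).
have My : M *m y = be *: x + al *: y.
  apply/matrixP => i j; rewrite ord1 !mxE /al /be.
  transitivity (complex.Im (z * w 0 i)).
    rewrite -wMi Im_sum; apply: eq_bigr => k _; rewrite mxE.
    by case: (w 0 k) => c d /=; ring.
  by case: z {wM wMi al be Mx} => ? ?; case: (w 0 i) => ? ? /=; ring.
pose f (s t : 'cV[R]_n) := (s^T *m P *m t) 0 0.
have f_sym s t : f s t = f t s.
  rewrite /f -[in LHS](trmxK (s^T *m P *m t)) mxE; congr (_ _ 0 0).
  by rewrite !trmx_mul trmxK P_sym mulmxA.
have fL s : (s^T *m (M^T *m P + P *m M) *m s) 0 0 = f s (M *m s) + f s (M *m s).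
  rewrite mulmxDr mulmxDl mxE; congr (_ + _); last by rewrite /f !mulmxA.
  by rewrite [RHS]f_sym /f trmx_mul !mulmxA.
have fD s t t' a b : f s (a *: t + b *: t') = a * f s t + b * f s t'.
  by rewrite /f mulmxDr -!scalemxAr !mxE.
have L : f x (M *m x) + f y (M *m y) = al * (f x x + f y y).
  by rewrite Mx My -scaleNr !fD (f_sym y x); ring.
have f_gt0 s : s != 0 -> 0 < f s s by move/P_pos.
have f_lt0 s : s != 0 -> f s (M *m s) < 0 by move/L_neg; rewrite fL; lra.
have f0 s : f s 0 = 0 by rewrite /f mulmx0 mxE.
rewrite -/al; have [x0|x_neq0] := eqVneq x 0; have [y0|y_neq0] := eqVneq y 0.
- case/eqP: w_neq0; apply/matrixP => i j; rewrite ord1 mxE.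
  move: x0 y0 => /matrixP/(_ j 0) + /matrixP/(_ j 0); rewrite !mxE.
  by case: (w 0 j) => c d /= -> ->.
- move: L (f_lt0 _ y_neq0) (f_gt0 _ y_neq0); rewrite x0 mulmx0 !f0; nra.
- move: L (f_lt0 _ x_neq0) (f_gt0 _ x_neq0); rewrite y0 mulmx0 !f0; nra.
- move: L (f_lt0 _ y_neq0) (f_gt0 _ y_neq0).
  by move: (f_lt0 _ x_neq0) (f_gt0 _ x_neq0); nra.
Qed.

Lemma diag_Riccati_stable_Hurwitz (R : realType) (n : nat) (A B : 'M[R]_n) :
  diag_Riccati_stable A B -> Hurwitz (A + B).
Proof.
move=> [P [Q [_ P_pos _ Q_pos Y_neg]]]; apply: (Lyapunov_Hurwitz P_pos).
exact: diag_Riccati_Lyapunov P_pos Q_pos Y_neg.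
Qed.

Lemma Hurwitz_tr (R : realType) (n : nat) (M : 'M[R]_n) :
  Hurwitz M -> Hurwitz M^T.
Proof.
by move=> M_Hur z; rewrite -matrix.map_trmx eigenvalue_tr; exact: M_Hur.
Qed.

(** * Strictly subinvariant vectors of Metzler matrices *)

Lemma exists_pos_below (R : realType) (n : nat) (f : 'I_n -> R) :
  (forall i, 0 < f i) -> exists2 e, 0 < e & forall i, e < f i.
Proof.
move=> f_gt0; have s_ge0 : 0 <= \sum_i (f i)^-1.
  by apply: sumr_ge0 => i _; rewrite invr_ge0 ltW.
have d_gt0 : 0 < 1 + \sum_i (f i)^-1 by rewrite ltr_pwDl.
exists (1 + \sum_i (f i)^-1)^-1; first by rewrite invr_gt0.
move=> i; rewrite -[f i]invrK ltf_pV2 ?posrE ?invr_gt0 //.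
rewrite [X in _ + X](bigD1 i) //= addrCA ltrDl ltr_pwDl //.
by apply: sumr_ge0 => j _; rewrite invr_ge0 ltW.
Qed.

Definition Metzler (R : realType) (n : nat) (M : 'M[R]_n) : Prop :=
  forall i j, i != j -> 0 <= M i j.

(** A Collatz-Wielandt certificate: for Metzler M such a v exists exactly when t
    exceeds the real parts of all eigenvalues of M. *)
Definition strict_subinvariant (R : realType) (n : nat) (M : 'M[R]_n) (t : R)
    (v : 'cV[R]_n) : Prop :=
  forall i, 0 < v i 0 /\ (M *m v) i 0 < t * v i 0.

(** A strictly subinvariant vector makes t - M inverse positive: at an index i
    minimizing x_i / v_i, a negative ratio r would give
    (M x)_i >= r (M v)_i > r t v_i = t x_i. *)
Lemma subinvariant_inverse_positive (R : realType) (n : nat) (M : 'M[R]_n)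
    t (v x : 'cV[R]_n) :
  Metzler M -> strict_subinvariant M t v ->
  (forall i, (M *m x) i 0 <= t * x i 0) -> forall i, 0 <= x i 0.
Proof.
move=> M_ge0 Mv Mx i0; rewrite leNgt; apply/negP => xi0_lt0.
have v_gt0 i : 0 < v i 0 by have [] := Mv i.
pose ratio i := x i 0 / v i 0.
case: (@arg_minP _ _ _ i0 xpredT ratio isT) => i _ ratio_min.
set r := ratio i in ratio_min.
have r_lt0 : r < 0.
  by apply: le_lt_trans (ratio_min i0 isT) _; rewrite pmulr_llt0 ?invr_gt0.
have xE : x i 0 = r * v i 0 by rewrite /r /ratio divfK ?gt_eqF.
have x_ge j : r * v j 0 <= x j 0 by rewrite -ler_pdivlMr ?ratio_min.
have [_ Mvi] := Mv i.
have : r * (M *m v) i 0 <= (M *m x) i 0.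
  rewrite !mxE mulr_sumr; apply: ler_sum => j _.
  have [->|ji] := eqVneq j i; first by rewrite xE mulrCA.
  by rewrite mulrCA ler_wpM2l // M_ge0 // eq_sym.
move/le_trans/(_ (Mx i)); rewrite xE mulrCA ler_nM2l // leNgt.
by rewrite Mvi.
Qed.

Lemma subinvariant_open (R : realType) (n : nat) (M : 'M[R]_n)
    t (v : 'cV[R]_n) :
  strict_subinvariant M t v ->
  exists2 e, 0 < e & strict_subinvariant M (t - e) v.
Proof.
move=> Mv; pose gap i := t - (M *m v) i 0 / v i 0.
have [i|e e_gt0 e_lt] := @exists_pos_below R n gap.
  by have [vi Mvi] := Mv i; rewrite /gap subr_gt0 ltr_pdivrMr.
exists e => // i; have [vi Mvi] := Mv i; split => //.
by rewrite -ltr_pdivrMr // ltrBrDr addrC -ltrBrDr e_lt.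
Qed.

Lemma subinvariant_le (R : realType) (n : nat) (M : 'M[R]_n)
    s t (v : 'cV[R]_n) :
  s <= t -> strict_subinvariant M s v -> strict_subinvariant M t v.
Proof.
move=> st Mv i; have [vi Mvi] := Mv i; split => //.
by apply: lt_le_trans Mvi _; rewrite ler_pM2r.
Qed.

Lemma exists_subinvariant (R : realType) (n : nat) (M : 'M[R]_n) :
  exists2 t, 0 <= t & strict_subinvariant M t (const_mx 1).
Proof.
have s_ge0 i : 0 <= \sum_j `|M i j| by apply: sumr_ge0.
exists (1 + \sum_i \sum_j `|M i j|).
  by apply: addr_ge0 => //; apply: sumr_ge0.
move=> i; rewrite !mxE mulr1; split=> //.
apply: (@le_lt_trans _ _ (\sum_j `|M i j|)).
  by apply: ler_sum => j _; rewrite mxE mulr1 ler_norm.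
rewrite [X in _ + X](bigD1 i) //= addrCA ltrDl ltr_pwDl //.
exact: sumr_ge0.
Qed.

(** Let t0 be the infimum of the t >= 0 with a strictly subinvariant vector, and
    solve (t0 - M) x = 1, which is possible by hypothesis.  Slightly above t0
    the matrix t - M is inverse positive and still maps x to a nonnegative
    vector, so x >= 0.  A zero coordinate of x would give
    0 <= (M x)_i = -1, so x > 0 is itself strictly subinvariant at t0.  By
    openness the infimum can only be 0. *)
Lemma subinvariant0 (R : realType) (n : nat) (M : 'M[R]_n) :
  Metzler M -> (forall t, 0 <= t -> t%:M - M \in unitmx) ->
  exists v, strict_subinvariant M 0 v.
Proof.
move=> M_ge0 M_unit.
pose E : classical_sets.set R := fun t =>
  0 <= t /\ exists v, strict_subinvariant M t v.
have E_lb : classical_sets.lbound E 0 by move=> t [].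
have E_has : classical_sets.has_lbound E by exists 0.
have E_n0 : classical_sets.nonempty E.
  have [t t_ge0 Mt] := exists_subinvariant M.
  by exists t; split => //; eexists; exact: Mt.
pose t0 := inf E.
have t0_ge0 : 0 <= t0 by exact: lb_le_inf.
pose x := invmx (t0%:M - M) *m (const_mx 1 : 'cV[R]_n).
have xE i : (M *m x) i 0 = t0 * x i 0 - 1.
  have : (t0%:M - M) *m x = const_mx 1 by rewrite mulKVmx ?M_unit.
  move/matrixP/(_ i 0); rewrite mulmxBl mul_scalar_mx mxE [X in X + _]mxE.
  rewrite [X in _ + X]mxE [RHS]mxE; lra.
(* With d |x_i| < 1 one gets ((t0 + d) x - M x)_i = 1 + d x_i >= 0. *)
have [i|d d_gt0 d_lt] := @exists_pos_below R n (fun i => (1 + `|x i 0|)^-1).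
  by rewrite invr_gt0 ltr_pwDl.
have [s [s_ge0 [v Mv]] st] : exists2 s, E s & s < t0 + d.
  by apply: inf_lt => //; rewrite ltrDl.
have x_ge0 : forall i, 0 <= x i 0.
  have Mdv := subinvariant_le (ltW st) Mv.
  apply: (subinvariant_inverse_positive M_ge0 Mdv) => i.
  rewrite xE mulrDl lerD2l lerNl.
  have := d_lt i; rewrite -[ltRHS]div1r ltr_pdivlMr ?ltr_pwDl // => d_lt1.
  by have := ler_norm (- x i 0); rewrite normrN => x_ge; nra.
have Mx : strict_subinvariant M t0 x.
  move=> i; rewrite xE; split; last by rewrite ltrBlDr ltrDl.
  rewrite lt_neqAle x_ge0 andbT eq_sym; apply/eqP => xi0.
  have : 0 <= (M *m x) i 0.
    rewrite mxE; apply: sumr_ge0 => j _.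
    have [->|ji] := eqVneq j i; first by rewrite xi0 mulr0.
    by rewrite mulr_ge0 // M_ge0 // eq_sym.
  by rewrite xE xi0 mulr0 add0r oppr_ge0 ler10.
have [e e_gt0 Mxe] := subinvariant_open Mx.
exists x; apply: (subinvariant_le _ Mxe); rewrite leNgt; apply/negP => te_gt0.
have : E (t0 - e) by split; [exact: ltW | exists x].
by move/(ge_inf E_has); rewrite -/t0 lerBrDr gerDl leNgt e_gt0.
Qed.

Lemma Metzler_Hurwitz_subinvariant0 (R : realType) (n : nat) (M : 'M[R]_n) :
  Metzler M -> Hurwitz M -> exists v, strict_subinvariant M 0 v.
Proof.
move=> M_ge0 M_Hur; apply: subinvariant0 => // t t_ge0.
rewrite unitmxE unitfE; apply/eqP => /eqP/det0P [v v_neq0 vM].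
have t_eig : eigenvalue M t.
  apply/eigenvalueP; exists v => //; apply/esym/eqP.
  by rewrite -subr_eq0 -mul_mx_scalar -mulmxBr vM.
have := M_Hur t%:C%C; rewrite eigenvalue_map => /(_ t_eig) /=.
by rewrite ltNge t_ge0.
Qed.

(** * Riccati stability of positive pairs *)

(** Weighting the inequality 2 x_i x_j <= (v_j / v_i) x_i^2 + (v_i / v_j) x_j^2
    by the nonnegative entries Y_ij bounds the form x^T Y x by the sum of the
    (Y v)_i x_i^2 / v_i, whose coefficients are negative. *)
Lemma Metzler_negdef (R : realType) (n : nat) (Y : 'M[R]_n) (v : 'cV[R]_n) :
  Y^T = Y -> Metzler Y -> strict_subinvariant Y 0 v -> negdef Y.
Proof.
move=> Y_sym Y_ge0 Yv; split=> // x x_neq0.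
have v_gt0 i : 0 < v i 0 by have [] := Yv i.
have v_neq0 i : v i 0 != 0 by rewrite gt_eqF.
pose g i j := Y i j * (v j 0 / v i 0 * x i 0 ^+ 2).
have gE i : \sum_j g i j = (Y *m v) i 0 * (x i 0 ^+ 2 / v i 0).
  rewrite mxE mulr_suml; apply: eq_bigr => j _; rewrite /g.
  by field; exact: v_neq0.
have q_le : (x^T *m Y *m x) 0 0 *+ 2 <= (\sum_i \sum_j g i j) *+ 2.
  rewrite [in leRHS]mulr2n [X in _ + X]exchange_big /= -big_split /=.
  rewrite quad_formE -sumrMnl; apply: ler_sum => i _.
  rewrite -big_split -sumrMnl; apply: ler_sum => j _ /=; rewrite /g.
  have -> : Y j i = Y i j by rewrite -[in LHS]Y_sym mxE.
  rewrite -mulrDr -mulrnAr; have [->|ij] := eqVneq i j.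
    by rewrite divff // mul1r expr2 mulr2n.
  apply: ler_wpM2l; first exact: Y_ge0.
  rewrite -subr_ge0.
  have -> : v j 0 / v i 0 * x i 0 ^+ 2 + v i 0 / v j 0 * x j 0 ^+ 2
      - (x i 0 * x j 0) *+ 2 =
      (v j 0 * x i 0 - v i 0 * x j 0) ^+ 2 / (v i 0 * v j 0).
    by field; rewrite !v_neq0.
  by rewrite divr_ge0 ?sqr_ge0 // mulr_ge0 // ltW.
rewrite lerMn2r /= in q_le; apply: le_lt_trans q_le _.
have g_le i : true -> 0 <= - \sum_j g i j.
  have vi_ge0 := ltW (v_gt0 i).
  move=> _; rewrite gE -mulNr mulr_ge0 // ?divr_ge0 ?sqr_ge0 //.
  by have [_] := Yv i; rewrite mul0r oppr_ge0 => /ltW.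
rewrite -oppr_gt0 -sumrN lt_neqAle sumr_ge0 // andbT eq_sym.
apply: contra x_neq0 => /eqP/(psumr_eq0P g_le) x0; apply/eqP/matrixP => i j.
have /eqP := x0 i isT; rewrite ord1 mxE gE oppr_eq0.
have [_] := Yv i; rewrite mul0r => /lt_eqF Yvi.
by rewrite !mulf_eq0 Yvi invr_eq0 (negbTE (v_neq0 i)) orbF orbb => /eqP.
Qed.

(** With P v = w and Q v = B^T w + e, one has Q^-1 B^T w <= v, so the Riccati
    matrix maps v to a vector that is at most
    (A + B)^T w + P (A + B) v + e, and this is negative for small e > 0. *)
Lemma Metzler_diag_Riccati_stable_of_subinvariant (R : realType) (n : nat)
    (A B : 'M[R]_n) (v w : 'cV[R]_n) :
  Metzler A -> (forall i j, 0 <= B i j) ->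
  strict_subinvariant (A + B) 0 v -> strict_subinvariant (A + B)^T 0 w ->
  diag_Riccati_stable A B.
Proof.
move=> A_ge0 B_ge0 Mv Mw.
have v_gt0 i : 0 < v i 0 by have [] := Mv i.
have w_gt0 i : 0 < w i 0 by have [] := Mw i.
have v_neq0 i : v i 0 != 0 by rewrite gt_eqF.
pose p : 'rV[R]_n := \row_i (w i 0 / v i 0).
have p_gt0 i : 0 < p 0 i by rewrite mxE divr_gt0.
have [i|e e_gt0 e_lt] := @exists_pos_below R n
    (fun i => - (((A + B)^T *m w) i 0 + p 0 i * ((A + B) *m v) i 0)).
  have [_ Mvi] := Mv i; have [_ Mwi] := Mw i; rewrite !mul0r in Mvi Mwi.
  by rewrite oppr_gt0 -[ltRHS]addr0 ltrD // pmulr_rlt0.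
have Bw_ge0 i : 0 <= (B^T *m w) i 0.
  by rewrite mxE; apply: sumr_ge0 => j _; rewrite mxE mulr_ge0 // ltW.
pose q : 'rV[R]_n := \row_i (((B^T *m w) i 0 + e) / v i 0).
have q_gt0 i : 0 < q 0 i by rewrite mxE divr_gt0 // ltr_wpDl.
have q_neq0 i : q 0 i != 0 by rewrite gt_eqF.
exists (diag_mx p), (diag_mx q); split.
- exact: diag_mx_is_diag.
- exact: posdef_diag.
- exact: diag_mx_is_diag.
- exact: posdef_diag.
rewrite invmx_diag //; set qi := \row_i (q 0 i)^-1.
have Pv : diag_mx p *m v = w.
  by apply/colP => i; rewrite mul_diag_mx !mxE divfK.
have qi_ge0 i : 0 <= qi 0 i by rewrite mxE invr_ge0 ltW.
apply: (@Metzler_negdef _ _ _ v).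
- rewrite !linearD /= !trmx_mul trmxK !tr_diag_mx !mulmxA.
  by rewrite trmxK [X in X + _ + _]addrC.
- have mul_nneg (X Y : 'M[R]_n) : (forall i j, 0 <= X i j) ->
      (forall i j, 0 <= Y i j) -> forall i j, 0 <= (X *m Y) i j.
    by move=> X_ge0 Y_ge0 i j; rewrite mxE sumr_ge0 // => k _; rewrite mulr_ge0.
  have diag_nneg (d : 'rV[R]_n) : (forall i, 0 <= d 0 i) ->
      forall i j, 0 <= diag_mx d i j.
    by move=> d_ge0 i j; rewrite mxE mulrn_wge0.
  have p_ge0 i : 0 <= p 0 i by rewrite ltW.
  move=> i j ij; rewrite 3!addmxE.
  rewrite addr_ge0 //; last first.
    have BT_ge0 i' j' : 0 <= B^T i' j' by rewrite mxE.
    have [P_ge0 Qi_ge0] := (diag_nneg _ p_ge0, diag_nneg _ qi_ge0).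
    by do 4![apply: (mul_nneg) => //].
  rewrite mul_mx_diag mul_diag_mx [diag_mx q _ _]mxE (negbTE ij) addr0 !mxE.
  have Aji : 0 <= A j i by rewrite A_ge0 // eq_sym.
  by rewrite addr_ge0 // mulr_ge0 ?divr_ge0 // ?A_ge0 // ltW.
- move=> i; split=> //; rewrite mul0r.
  have Qv : (diag_mx q *m v) i 0 = (B^T *m w) i 0 + e.
    by rewrite mul_diag_mx mxE [q _ _]mxE divfK.
  have BQ : (B *m (diag_mx qi *m (B^T *m w))) i 0 <= (B *m v) i 0.
    rewrite mxE [leRHS]mxE; apply: ler_sum => j _; apply: ler_wpM2l => //.
    rewrite mul_diag_mx mxE [qi _ _]mxE mulrC ler_pdivrMr // !mxE.
    by rewrite mulrC divfK // lerDl ltW.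
  rewrite !mulmxDl -!mulmxA Pv.
  rewrite 3!addmxE Qv !mul_diag_mx_coef.
  have := e_lt i; have := ler_wpM2l (ltW (p_gt0 i)) BQ.
  by rewrite linearD /= !mulmxDl !addmxE mulrDr; lra.
Qed.

Lemma Metzler_diag_Riccati_stableP (R : realType) (n : nat) (A B : 'M[R]_n) :
  Metzler A -> (forall i j, 0 <= B i j) ->
  diag_Riccati_stable A B <-> Hurwitz (A + B).
Proof.
move=> A_ge0 B_ge0; split; first exact: diag_Riccati_stable_Hurwitz.
have M_ge0 : Metzler (A + B) by move=> i j ij; rewrite mxE addr_ge0 ?A_ge0.
have MT_ge0 : Metzler (A + B)^T.
  by move=> i j ij; rewrite mxE; apply: M_ge0; rewrite eq_sym.
move=> M_Hur; have [v Mv] := Metzler_Hurwitz_subinvariant0 M_ge0 M_Hur.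
have [w Mw] := Metzler_Hurwitz_subinvariant0 MT_ge0 (Hurwitz_tr M_Hur).
exact: (Metzler_diag_Riccati_stable_of_subinvariant A_ge0 B_ge0 Mv Mw).
Qed.

(** * Signature transformations *)

Lemma negdef_congr (R : realType) (n : nat) (M S : 'M[R]_n) :
  S \in unitmx -> negdef M -> negdef (S^T *m M *m S).
Proof.
move=> S_unit [M_sym M_neg]; split.
  by rewrite !trmx_mul trmxK M_sym mulmxA.
move=> x x_neq0; have Sx_neq0 : S *m x != 0.
  by apply: contra x_neq0 => /eqP Sx0; rewrite -(mulKmx S_unit x) Sx0 mulmx0.
by have := M_neg _ Sx_neq0; rewrite trmx_mul !mulmxA.
Qed.

(** S and T commute with the diagonal matrices P and Q, so the same P and Q
    serve for the transformed pair: its Riccati matrix is S Y S, where Y is the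
    original one. *)
Lemma diag_Riccati_stable_sign (R : realType) (n : nat) (A B : 'M[R]_n)
    (s t : 'rV[R]_n) (S := diag_mx s) (T := diag_mx t) :
  S *m S = 1%:M -> T *m T = 1%:M ->
  diag_Riccati_stable A B -> diag_Riccati_stable (S *m A *m S) (S *m B *m T).
Proof.
move=> SS TT [P [Q [P_diag P_pos Q_diag Q_pos Y_neg]]].
exists P, Q; split => //.
have [S_unit _] := mulmx1_unit SS.
have Q_unit := posdef_unitmx Q_pos.
have [p Pp] := diag_mxP P P_diag; have [q Qq] := diag_mxP Q Q_diag.
have SP : S *m P = P *m S by rewrite Pp; exact: diag_mx_comm.
have SQ : S *m Q = Q *m S by rewrite Qq; exact: diag_mx_comm.
have TQ : T *m Q = Q *m T by rewrite Qq; exact: diag_mx_comm.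
have TQT : T *m invmx Q *m T = invmx Q.
  rewrite -[LHS](mulKmx Q_unit) 2!(mulmxA Q) -TQ.
  by rewrite -(mulmxA T) mulmxV // mulmx1 TT mulmx1.
have := negdef_congr S_unit Y_neg; congr negdef.
rewrite !trmx_mul !tr_diag_mx -/S -/T !mulmxDr !mulmxDl.
congr (_ + _ + _ + _).
- by rewrite !mulmxA -!mulmxA -SP.
- by rewrite !mulmxA SP.
- by rewrite SQ -mulmxA SS mulmx1.
rewrite -[in LHS]TQT !mulmxA SP -!mulmxA; do 7!congr (_ *m _).
by rewrite SP.
Qed.

Lemma tr_tridiag_mx (R : realType) (n : nat) (a : 'I_n -> R)
    (u l : 'I_n.-1 -> R) :
  (tridiag_mx a u l)^T = tridiag_mx a l u.
Proof.
apply/matrixP => i j; rewrite !mxE addrAC eq_sym.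
have -> : a j *+ (i == j) = a i *+ (i == j) by case: eqVneq => [->|].
by congr (_ + _ + _); apply: eq_bigr => m _; rewrite andbC.
Qed.

Lemma tridiag_mx_upper (R : realType) (n : nat) (a : 'I_n -> R)
    (u l : 'I_n.-1 -> R) (m : 'I_n.-1) (i j : 'I_n) :
  i = m :> nat -> j = m.+1 :> nat -> tridiag_mx a u l i j = u m.
Proof.
move=> im jm; rewrite mxE (bigD1 m) //= im jm !eqxx mulr1n.
have -> : (i == j) = false by rewrite -val_eqE /= im jm ltn_eqF.
rewrite !big1 ?addr0 ?add0r // => [m' _|m' m'm].
  by case: eqP => // ->; rewrite eqn_leq ltnNge leqnSn andbF.
by rewrite [X in X && _]eq_sym val_eqE (negbTE m'm).
Qed.

Lemma tridiag_mx_far (R : realType) (n : nat) (a : 'I_n -> R)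
    (u l : 'I_n.-1 -> R) (i j : 'I_n) :
  i != j -> j != i.+1 :> nat -> i != j.+1 :> nat -> tridiag_mx a u l i j = 0.
Proof.
move=> ij ji1 ij1; rewrite mxE (negbTE ij) !big1 ?addr0 // => m _.
  by rewrite andbC; case: eqP => // <-; rewrite (negbTE ij1).
by case: eqP => // <-; rewrite (negbTE ji1).
Qed.

(** The signature is built so that consecutive entries multiply to the sign
    shared by u_m and l_m; on a path these are the only conditions. *)
Lemma tridiag_mx_hat (R : realType) (n : nat) (a : 'I_n -> R)
    (u l : 'I_n.-1 -> R) (A := tridiag_mx a u l) :
  (forall i, 0 <= l i * u i) ->
  exists2 s : 'rV[R]_n, (forall i, s 0 i * s 0 i = 1) &
    hat_mx A = diag_mx s *m A *m diag_mx s.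
Proof.
move=> lu_ge0; pose sg m : R := if (u m < 0) || (l m < 0) then -1 else 1.
have sg2 m : sg m * sg m = 1 by rewrite /sg; case: ifP => _; ring.
have sgu m : `|u m| = sg m * u m.
  rewrite /sg; case: (ltrgt0P (u m)) => [u_gt0|u_lt0|->] /=.
  - by have := lu_ge0 m; rewrite pmulr_lge0 // leNgt; case: ltP; rewrite ?mul1r.
  - by rewrite mulN1r.
  - by rewrite mulr0.
have sgl m : `|l m| = sg m * l m.
  rewrite /sg; case: (ltrgt0P (l m)) => [l_gt0|l_lt0|->] /=.
  - by have := lu_ge0 m; rewrite pmulr_rge0 // leNgt; case: ltP; rewrite ?mul1r.
  - by rewrite orbT mulN1r.
  - by rewrite mulr0.
pose s : 'rV[R]_n := \row_(i < n) \prod_(m < n.-1 | (m < i)%N) sg m.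
have s2 i : s 0 i * s 0 i = 1.
  by rewrite mxE -big_split big1 //= => m _; exact: sg2.
have s_step (m : 'I_n.-1) (i j : 'I_n) :
    i = m :> nat -> j = m.+1 :> nat -> s 0 j = s 0 i * sg m.
  move=> im jm; rewrite !mxE (bigD1 m) ?jm ?leqnn //= mulrC im; congr (_ * _).
  by apply: eq_bigl => m'; rewrite ltnS ltn_neqAle andbC.
exists s => //; apply/matrixP => i j.
rewrite mul_mx_diag mxE [RHS]mxE mul_diag_mx [X in X * _]mxE.
have [<-|ij] := eqVneq i j; first by rewrite mulrAC s2 mul1r.
have [ji1|ji1] := eqVneq (j : nat) i.+1.
  have m_lt : (i < n.-1)%N.
    rewrite -ltnS prednK -?ji1 //.
    exact: leq_ltn_trans (ltn_ord j).
  rewrite /A (@tridiag_mx_upper _ _ _ _ _ (Ordinal m_lt)) //.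
  rewrite (s_step (Ordinal m_lt) i j) // sgu mulrACA s2 mul1r.
  exact: mulrC.
have [ij1|ij1] := eqVneq (i : nat) j.+1.
  have m_lt : (j < n.-1)%N.
    rewrite -ltnS prednK -?ij1 //.
    exact: leq_ltn_trans (ltn_ord i).
  have -> : A i j = l (Ordinal m_lt).
    by rewrite -[A]trmxK mxE tr_tridiag_mx; exact: tridiag_mx_upper.
  rewrite (s_step (Ordinal m_lt) j i) // sgl -mulrA (mulrC (l _)) mulrACA.
  by rewrite s2 mul1r.
by rewrite /A tridiag_mx_far // normr0 mulr0 mul0r.
Qed.

(** Only row k of B is nonzero, so the column signs can absorb both the signs of
    b and the entry k of the prescribed signature s. *)
Lemma delta_row_bar (R : realType) (n : nat) (b : 'cV[R]_n) (k : 'I_n)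
    (s : 'rV[R]_n) (B := delta_mx k (0 : 'I_1) *m b^T) :
  (forall i, s 0 i * s 0 i = 1) ->
  exists2 t : 'rV[R]_n, (forall i, t 0 i * t 0 i = 1) &
    bar_mx B = diag_mx s *m B *m diag_mx t.
Proof.
move=> s2; pose sg j : R := if b j 0 < 0 then -1 else 1.
have sg2 j : sg j * sg j = 1 by rewrite /sg; case: ifP => _; ring.
exists (\row_j (s 0 k * sg j)) => [j|].
  by rewrite mxE mulrACA s2 sg2 mulr1.
apply/matrixP => i j; rewrite mul_mx_diag mul_diag_mx !mxE big_ord1 !mxE andbT.
have [->|ik] := eqVneq i k; last by rewrite mul0r normr0 mulr0 mul0r.
rewrite mul1r mulrACA s2 mul1r mulrC /sg.
by case: ltP => [/ltr0_norm ->|/ger0_norm ->]; rewrite ?mulN1r ?mul1r.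
Qed.

(** * Tridiagonal pairs *)

Theorem proposition3p3 (R : realType) (n : nat)
    (a : 'I_n -> R) (u l : 'I_n.-1 -> R) (b : 'cV[R]_n) (k : 'I_n) (A B : 'M[R]_n)
    (hA : A = tridiag_mx a u l)
    (hlu : forall i : 'I_n.-1, 0 <= l i * u i)
    (hB : B = delta_mx k (0 : 'I_1) *m b^T) :
  diag_Riccati_stable A B <-> Hurwitz (hat_mx A + bar_mx B).
Proof.
have [s s2 hatA] := tridiag_mx_hat a hlu.
have [t t2 barB] := delta_row_bar b k s2.
rewrite -hA in hatA; rewrite -hB in barB.
have SS := sign_diag_mx s2; have TT := sign_diag_mx t2.
have hat_Metzler : Metzler (hat_mx A) by move=> i j ij; rewrite mxE (negbTE ij).
have bar_ge0 i j : 0 <= bar_mx B i j by rewrite mxE.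
apply: (iff_trans _ (Metzler_diag_Riccati_stableP hat_Metzler bar_ge0)).
split; first by rewrite hatA barB; exact: diag_Riccati_stable_sign.
move/(diag_Riccati_stable_sign SS TT).
by rewrite hatA barB -!mulmxA SS TT !mulmxA SS !mul1mx !mulmx1.
Qed.
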